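(* Let $F$ be a field of characteristic $0$, and let $A(x)$ and $B(x)$ be rational power series over $F$. Then $A(x)$ and $B(x)$ can be expressed as $$A(x)=\frac{R(x)}{\prod_{i=1}^m(1-\alpha_i x)},\qquad B(x)=\frac{S(x)}{\prod_{j=1}^n(1-\beta_j x)},$$ where the $\alpha_i$ and $\beta_j$ lie in some extension field $K$ of $F$ (the $\alpha_i$ need not be distinct nor nonzero, and likewise for the $\beta_j$), and $R(x),S(x)$ are polynomials over $K$ with $\deg R(x)<m$ and $\deg S(x)<n$. Moreover, for any such expressions, $$A(x)\odot B(x)=\frac{T(x)}{\prod_{i=1}^m\prod_{j=1}^n\bigl(1-(\alpha_i+\beta_j)x\bigr)}$$ for some polynomial $T(x)$ (over $K$) of degree at most $mn-1$.
   Context: For formal power series with coefficients in a field of characteristic $0$, the binomial product $\odot$ is defined by $\sum_{n\ge0}a_nx^n\odot\sum_{n\ge0}b_nx^n=\sum_{n\ge0}c_nx^n$, where $c_n=\sum_{k=0}^n\binom nk a_kb_{n-k}$. A rational power series over $F$ is a formal power series with coefficients in $F$ that equals a quotient of two polynomials over $F$. The zero polynomial is regarded as having degree $-\infty$. *)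

(* Defs.v *)
From HB Require Import structures.
From mathcomp Require Import all_boot all_algebra.

Set Implicit Arguments.
Unset Strict Implicit.
Unset Printing Implicit Defensive.

Import GRing.Theory.
Local Open Scope ring_scope.

(* A formal power series \sum_n (a n) x^n, given by its coefficients;
   equality of power series is pointwise equality [=1]. *)
Definition fps (R : nzRingType) := nat -> R.

Definition fps_of_poly (R : nzRingType) (p : {poly R}) : fps R := fun n => p`_n.

Definition fps_map (R S : nzRingType) (f : R -> S) (a : fps R) : fps S :=
  fun n => f (a n).

Definition fps_mul (R : nzRingType) (a b : fps R) : fps R :=
  fun n => \sum_(k < n.+1) a k * b (n - k)%N.

Definition binomial_product (R : nzRingType) (a b : fps R) : fps R :=
  fun n => \sum_(k < n.+1) 'C(n, k)%:R * a k * b (n - k)%N.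

(* a = p / q. The constant term of q may vanish, so q need not be invertible
   as a power series; the equation is the one in the field of fractions of the
   domain K[[x]], cleared of its denominator. *)
Definition fps_eq_quotient (K : fieldType) (a : fps K) (p q : {poly K}) : Prop :=
  q != 0 /\ fps_mul (fps_of_poly q) a =1 fps_of_poly p.

Definition rational_fps (K : fieldType) (a : fps K) : Prop :=
  exists p q : {poly K}, fps_eq_quotient a p q.

(* Main.v *)
Require Import Defs.
From HB Require Import structures.
From mathcomp Require Import all_boot all_algebra.
From mathcomp Require Import fieldext.
From Stdlib Require Import Classical_Prop.

Set Implicit Arguments.
Unset Strict Implicit.
Unset Printing Implicit Defensive.

Import GRing.Theory.
Local Open Scope ring_scope.

(** Saying that a series is a polynomial of degree < m divided by
    (1 - c_1 x)...(1 - c_m x) is saying that its coefficient sequence a is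
    annihilated by the operator (E - c_1)...(E - c_m), where E is the shift
    n |-> a (n + 1): multiplying the series by the denominator computes this
    operator from the coefficient of x^m on ([fps_mul_recip_prod]).

    In these terms the theorem is about a product that E differentiates. By
    Pascal's rule the shift is a derivation for the binomial product, as d/dx
    is for the product of exponential generating functions, so that
      (E - (c + d)) (a . b) = ((E - c) a) . b + a . ((E - d) b)
    ([shift_sub_binomial_product]). If the c_i annihilate a and the d_j
    annihilate b, each term on the right has one root fewer on one side, and
    induction on both lists of roots shows that the product of all
    E - (c_i + d_j) annihilates a . b ([kills_binomial_product]). Repeated roots
    need no separate treatment, and partial fractions are avoided.

    For the existence of the split forms, the product of the two denominators is
    split into linear factors over an extension field. A factor X is cancelled
    against the numerator, any other factor X - r is a constant times
    1 - r^-1 X, and factors 1 - 0 X are appended until their number exceeds the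
    degree of the numerator. *)

(** * Splitting fields *)

(** Irreducibility is undecidable over an abstract field, so the case split
    between adjoining a root of p and passing to a proper factor of p is
    classical. *)
Lemma exists_root_ext (F : fieldType) (p : {poly F}) : (1 < size p)%N ->
  exists (L : fieldType) (iota : {rmorphism F -> L}) (z : L),
    root (map_poly iota p) z.
Proof.
have [n] := ubnP (size p); elim: n p => // n IHn p lt_p_n p_gt1.
have [/irredp_FAdjoin[L _ [z pz0 _]] | red_p] := classic (irreducible_poly p).
  by exists L, (in_alg L), z.
have [q [q_neq1 q_dv_p q_neqp]] :
    exists q : {poly F}, [/\ size q != 1, q %| p & ~~ (q %= p)].
  apply: NNPP => no_q; apply: red_p; split=> // q q_neq1 q_dv_p.
  by apply/idPn => q_neqp; apply: no_q; exists q.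
have p_neq0 : p != 0 by rewrite -size_poly_gt0 ltnW.
have q_neq0 : q != 0 by apply: contraNneq p_neq0 => q0; rewrite -dvd0p -q0.
have lt_q_p : (size q < size p)%N.
  by rewrite ltn_neqAle dvdp_leq // andbT dvdp_size_eqp.
have q_gt1 : (1 < size q)%N by rewrite ltn_neqAle eq_sym q_neq1 size_poly_gt0.
have [L [iota [z qz0]]] := IHn q (leq_trans lt_q_p lt_p_n) q_gt1.
exists L, iota, z; move: qz0; rewrite -!dvdp_XsubCl => /dvdp_trans.
by apply; rewrite dvdp_map.
Qed.

(** Each induction step adjoins one root and divides it out, so the base field
    changes along the induction. *)
Lemma exists_splitting_ext (F : fieldType) (p : {poly F}) : p != 0 ->
  exists (K : fieldType) (iota : {rmorphism F -> K}) (rs : seq K),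
    map_poly iota p %= \prod_(r <- rs) ('X - r%:P).
Proof.
have [n] := ubnP (size p); elim: n F p => // n IHn F p lt_p_n p_neq0.
have [p_le1 | p_gt1] := leqP (size p) 1.
  exists F, idfun, [::]; rewrite big_nil map_poly_id // -size_poly_eq1.
  by rewrite eqn_leq p_le1 size_poly_gt0.
have [L [iota [z /factor_theorem[q Dp]]]] := exists_root_ext p_gt1.
have q_neq0 : q != 0.
  have: map_poly iota p != 0 by rewrite map_poly_eq0.
  by apply: contraNneq => q0; rewrite Dp q0 mul0r.
have sz_p : size p = (size q).+1.
  rewrite -(size_map_poly iota) Dp size_Mmonic ?monicXsubC //.
  by rewrite size_XsubC addn2.
have lt_q_n : (size q < n)%N by rewrite -ltnS -sz_p.
have [K [kappa [rs Dq]]] := IHn L q lt_q_n q_neq0.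
exists K, (kappa \o iota), (kappa z :: rs).
rewrite map_poly_comp Dp rmorphM /= map_polyXsubC big_cons mulrC.
by rewrite eqp_mul2l ?polyXsubC_eq0.
Qed.

Section Sequences.

Variable K : fieldType.
Implicit Types (a b : fps K) (p q G R : {poly K}) (s t : seq K).

(** * Products of a polynomial and a power series *)

Lemma fps_mulBl p q a n :
  fps_mul (fps_of_poly (p - q)) a n =
  fps_mul (fps_of_poly p) a n - fps_mul (fps_of_poly q) a n.
Proof.
rewrite -sumrB; apply: eq_bigr => k _.
by rewrite /fps_of_poly coefB mulrBl.
Qed.

Lemma fps_mulZl c p a n :
  fps_mul (fps_of_poly (c *: p)) a n = c * fps_mul (fps_of_poly p) a n.
Proof.
rewrite mulr_sumr; apply: eq_bigr => k _.
by rewrite /fps_of_poly coefZ mulrA.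
Qed.

Lemma fps_mulXl p a n :
  fps_mul (fps_of_poly (p * 'X)) a n.+1 = fps_mul (fps_of_poly p) a n.
Proof.
rewrite /fps_mul /fps_of_poly big_ord_recl coefMX mul0r add0r.
by apply: eq_bigr => k _; rewrite coefMX.
Qed.

Lemma fps_mul1l a : fps_mul (fps_of_poly 1) a =1 a.
Proof.
move=> n; rewrite /fps_mul /fps_of_poly big_ord_recl coef1 mul1r subn0.
by rewrite big1 ?addr0 // => k _; rewrite coef1 mul0r.
Qed.

Definition recip_prod s : {poly K} := \prod_(c <- s) (1 - c *: 'X).

Lemma recip_prod_neq0 s : recip_prod s != 0.
Proof.
have: (recip_prod s).[0] = 1.
  by rewrite horner_prod big1 // => c _; rewrite !hornerE subr0.
by apply: contra_eq_neq => ->; rewrite horner0 eq_sym oner_neq0.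
Qed.

(** The factors X - r are turned one by one into factors 1 - r^-1 X, the
    converted ones being moved into G. For r = 0 no such form exists;
    but then both sides of the equation are divisible by X. *)
Lemma recip_prod_of_roots s a G R :
    fps_mul (fps_of_poly (G * \prod_(r <- s) ('X - r%:P))) a
      =1 fps_of_poly R ->
  exists t R', fps_mul (fps_of_poly (G * recip_prod t)) a =1 fps_of_poly R'.
Proof.
elim: s G R => [|r s IHs] G R.
  by rewrite big_nil => eqR; exists [::], R; rewrite /recip_prod big_nil.
rewrite big_cons; have [-> | r_neq0] := eqVneq r 0 => eqR.
  apply: (IHs _ (drop_poly 1 R)) => n.
  rewrite /fps_of_poly coef_drop_poly addn1.
  by rewrite -[RHS]eqR polyC0 subr0 mulrCA ['X * _]mulrC fps_mulXl.
have /IHs[t [R' eqR']] : fps_mul (fps_of_poly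
    (G * (1 - r^-1 *: 'X) * \prod_(x <- s) ('X - x%:P))) a
    =1 fps_of_poly (- r^-1 *: R).
  move=> n; rewrite /fps_of_poly coefZ -[R`_n]eqR -fps_mulZl.
  congr (fps_mul (fps_of_poly _) a n); rewrite mulrA scalerAl scalerAr.
  congr (_ * _ * _); rewrite scalerBr scaleNr scale_polyC mulNr mulVf //.
  by rewrite rmorphN opprK addrC.
by exists (r^-1 :: t), R'; rewrite /recip_prod big_cons mulrA.
Qed.

(** Zero is allowed among the inverse roots, so the denominator can be given
    enough trivial factors to make the fraction formally proper. *)
Lemma fps_eq_quotient_pad s a R :
    fps_mul (fps_of_poly (recip_prod s)) a =1 fps_of_poly R ->
  exists2 t, (size R <= size t)%N & fps_eq_quotient a R (recip_prod t).
Proof.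
move=> eqR; exists (s ++ nseq (size R) 0).
  by rewrite size_cat size_nseq leq_addl.
split; first exact: recip_prod_neq0.
rewrite /recip_prod big_cat /= [X in _ * X]big1_seq ?mulr1 // => c /=.
by rewrite mem_nseq => /andP[_ /eqP->]; rewrite scale0r subr0.
Qed.

(** * The functional attached to a sequence *)

(** This is the linear functional on polynomials sending X^n to [a n]. The shift
    of the sequence becomes multiplication by X, so polynomials in the shift
    operator act on a through multiplication of the argument. *)
Definition lin a p : K := \sum_(i < size p) p`_i * a i.

Lemma lin_widen a p n : (size p <= n)%N -> lin a p = \sum_(i < n) p`_i * a i.
Proof.
move=> le_p_n; rewrite /lin (big_ord_widen n (fun i => p`_i * a i)) //.
rewrite big_mkcond; apply: eq_bigr => i _.
by case: ltnP => // le_p_i; rewrite nth_default ?mul0r.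
Qed.

Lemma lin_is_linear a : scalar (lin a).
Proof.
move=> c p q; pose n := maxn (size p) (size q).
have le_n: (size (c *: p + q)%R <= n)%N.
  by rewrite (leq_trans (size_polyD _ _)) // geq_max leq_maxr
       (leq_trans (size_scale_leq _ _)) ?leq_maxl.
rewrite (lin_widen _ le_n) !(@lin_widen a _ n) ?leq_maxl ?leq_maxr //.
rewrite mulr_sumr -big_split; apply: eq_bigr => i _.
by rewrite coefD coefZ mulrDl mulrA.
Qed.

HB.instance Definition _ a :=
  GRing.isLinear.Build K {poly K} K _ (lin a) (lin_is_linear a).

Lemma linXn a n : lin a 'X^n = a n.
Proof.
rewrite (@lin_widen _ _ n.+1) ?size_polyXn // (bigD1 ord_max) //= coefXn eqxx.
rewrite mul1r big1 ?addr0 // => i /negPf; rewrite coefXn -val_eqE => /= ->.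
by rewrite mul0r.
Qed.

(** The operator p(E), with E the shift, annihilates a. Testing against every q
    rather than every power of X makes the stability under multiples of p
    immediate. *)
Definition kills p a := forall q, lin a (p * q) = 0.

Lemma kills_powers p a : (forall n, lin a (p * 'X^n) = 0) -> kills p a.
Proof.
move=> pX0 q; rewrite -[q]coefK poly_def mulr_sumr linear_sum big1 // => i _.
by rewrite -scalerAr linearZ /= pX0 mulr0.
Qed.

Lemma kills_dvdp p q a : p %| q -> kills p a -> kills q a.
Proof.
by case/Pdiv.Field.dvdpP => r -> p_a u; rewrite mulrAC mulrC.
Qed.

Lemma kills_add p a b : kills p a -> kills p b -> kills p (fun n => a n + b n).
Proof.
move=> p_a p_b q; rewrite -[RHS](addr0 0) -{1}(p_a q) -(p_b q) -big_split.
by apply: eq_bigr => i _; rewrite mulrDr.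
Qed.

Lemma eq_kills p a b : a =1 b -> kills p a -> kills p b.
Proof.
by move=> eq_ab p_a q; rewrite -(p_a q); apply: eq_bigr => i _; rewrite eq_ab.
Qed.

Lemma kills_zero p : kills p (fun=> 0).
Proof. by move=> q; apply: big1 => i _; rewrite mulr0. Qed.

Lemma kills1 a : kills 1 a -> a =1 fun=> 0.
Proof. by move=> a0 n; rewrite -(a0 'X^n) mul1r linXn. Qed.

Definition shift_sub c a : fps K := fun n => a n.+1 - c * a n.

Lemma lin_shift_sub c a p : lin (shift_sub c a) p = lin a (('X - c%:P) * p).
Proof.
rewrite -[p]coefK poly_def mulr_sumr !linear_sum; apply: eq_bigr => i _ /=.
rewrite -scalerAr !linearZ /= linXn mulrBl linearB /= -exprS mul_polyC linearZ.
by rewrite /= !linXn.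
Qed.

(** * Rational series with split denominator as linear recurrences *)

Definition char_prod s : {poly K} := \prod_(c <- s) ('X - c%:P).

(** [recip_prod s] is the reciprocal polynomial of [char_prod s], so the
    convolution with the former is, from index [size s] on, the action of the
    latter on the shifts of a. *)
Lemma fps_mul_recip_prod s a n :
  fps_mul (fps_of_poly (recip_prod s)) a (n + size s)%N =
  lin a (char_prod s * 'X^n).
Proof.
elim: s n => [|c s IHs] n.
  by rewrite /recip_prod /char_prod !big_nil fps_mul1l /= addn0 mul1r linXn.
rewrite /recip_prod /char_prod !big_cons -/(recip_prod s) -/(char_prod s) /=.
rewrite mulrBl mul1r -scalerAl ['X * _]mulrC fps_mulBl fps_mulZl addnS.
rewrite fps_mulXl -addSn !IHs -mulrA mulrBl mul_polyC linearB linearZ /=.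
by rewrite mulrCA -exprS.
Qed.

Lemma kills_of_quotient s a R : (size R <= size s)%N ->
  fps_eq_quotient a R (recip_prod s) -> kills (char_prod s) a.
Proof.
move=> szR [_ eqR]; apply: kills_powers => n; rewrite -fps_mul_recip_prod eqR.
by rewrite /fps_of_poly nth_default // (leq_trans szR) ?leq_addl.
Qed.

(** The numerator has to be the initial segment of the product of the
    denominator and the series; annihilation makes the rest of that
    product vanish. *)
Lemma quotient_of_kills s a : kills (char_prod s) a ->
  exists R, (size R <= size s)%N /\ fps_eq_quotient a R (recip_prod s).
Proof.
move=> s_a.
exists (\poly_(i < size s) fps_mul (fps_of_poly (recip_prod s)) a i).
split; first exact: size_poly.
split=> [|n]; first exact: recip_prod_neq0.
rewrite /fps_of_poly coef_poly; case: ltnP => // /subnK <-.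
by rewrite fps_mul_recip_prod s_a.
Qed.

(** * The binomial product *)

(** The Leibniz rule for the shift, which is Pascal's rule. *)
Lemma binomial_product_shift a b n :
  binomial_product a b n.+1 =
  binomial_product (fun i => a i.+1) b n +
  binomial_product a (fun i => b i.+1) n.
Proof.
rewrite /binomial_product big_ord_recl bin0 subn0.
under eq_bigr => k _ do
  rewrite lift0 subSS binS natrD !mulrDl addrC.
rewrite big_split /= addrCA; congr (_ + _).
(* The last term on the left carries the factor 'C(n, n + 1) = 0. *)
rewrite [in RHS]big_ord_recl [in LHS]big_ord_recr /= bin0 subn0.
rewrite bin_small // !mul0r addr0; congr (_ + _).
by apply: eq_bigr => k _; rewrite /= /bump leq0n add1n subnSK.
Qed.

(** For a derivation D, (D - (c + d)) (a b) = ((D - c) a) b + a ((D - d) b).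
    This is where sums of inverse roots come from. *)
Lemma shift_sub_binomial_product c d a b :
  shift_sub (c + d) (binomial_product a b) =1
  (fun n => binomial_product (shift_sub c a) b n
          + binomial_product a (shift_sub d b) n).
Proof.
move=> n; rewrite /shift_sub binomial_product_shift mulrDl opprD addrACA.
congr (_ + _); rewrite /binomial_product mulr_sumr -sumrB;
  apply: eq_bigr => k _.
  by rewrite mulrBr mulrBl [c * _]mulrA [c * _]mulrCA.
by rewrite mulrBr [d * _]mulrCA.
Qed.

Lemma kills_cons c p a : kills (('X - c%:P) * p) a <-> kills p (shift_sub c a).
Proof.
by split=> p_a q; have := p_a q; rewrite -mulrA lin_shift_sub.
Qed.

Definition pair_sums s t : seq K := [seq c + d | c <- s, d <- t].

Lemma char_prod_cons c s : char_prod (c :: s) = ('X - c%:P) * char_prod s.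
Proof. exact: big_cons. Qed.

Lemma char_prod_pair_sums s t :
  char_prod (pair_sums s t) =
  \prod_(c <- s) \prod_(d <- t) ('X - (c + d)%:P).
Proof. exact: big_allpairs_dep. Qed.

(** The pair of heads (c, d) is used to differentiate. The two resulting terms
    are annihilated by the products over the pairs from (s, d :: t) and from
    (c :: s, t); both index sets avoid (c, d), so both products divide the
    product over all the remaining pairs. *)
Lemma kills_binomial_product s t a b :
    kills (char_prod s) a -> kills (char_prod t) b ->
  kills (char_prod (pair_sums s t)) (binomial_product a b).
Proof.
elim: s t a b => [|c s IHs] t a b s_a t_b.
  move: s_a; rewrite /char_prod big_nil => /kills1 a0.
  apply: eq_kills (@kills_zero _) => n.
  by rewrite [RHS]big1 // => k _; rewrite a0 mulr0 mul0r.
elim: t b t_b => [|d t IHt] b t_b.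
  move: t_b; rewrite {1}/char_prod big_nil => /kills1 b0.
  apply: eq_kills (@kills_zero _) => n.
  by rewrite [RHS]big1 // => k _; rewrite b0 mulr0.
have a'_s : kills (char_prod s) (shift_sub c a).
  by apply/kills_cons; rewrite -char_prod_cons.
have b'_t : kills (char_prod t) (shift_sub d b).
  by apply/kills_cons; rewrite -char_prod_cons.
rewrite char_prod_pair_sums big_cons big_cons -mulrA; apply/kills_cons.
apply: eq_kills (fsym (shift_sub_binomial_product c d a b)) _.
apply: kills_add.
  apply: kills_dvdp (IHs _ _ _ a'_s t_b).
  by rewrite char_prod_pair_sums dvdp_mull.
apply: kills_dvdp (IHt _ b'_t).
rewrite char_prod_pair_sums big_cons dvdp_mul //.
under [X in _ %| X]eq_bigr do rewrite big_cons.
by rewrite big_split dvdp_mull.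
Qed.

End Sequences.

(** * Extension of scalars *)

Lemma fps_map_mul (F K : fieldType) (iota : {rmorphism F -> K})
    (p q : {poly F}) (a : fps F) :
    fps_mul (fps_of_poly q) a =1 fps_of_poly p ->
  fps_mul (fps_of_poly (map_poly iota q)) (fps_map iota a)
    =1 fps_of_poly (map_poly iota p).
Proof.
move=> eqp n; rewrite /fps_of_poly coef_map -[p`_n]eqp /fps_mul /= rmorph_sum.
by apply: eq_bigr => k _; rewrite rmorphM coef_map.
Qed.

Lemma fps_map_binomial_product (F K : fieldType) (iota : {rmorphism F -> K})
    (a b : fps F) :
  fps_map iota (binomial_product a b)
    =1 binomial_product (fps_map iota a) (fps_map iota b).
Proof.
move=> n; rewrite /fps_map /binomial_product /= rmorph_sum.
apply: eq_bigr => k _.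
by rewrite !rmorphM rmorph_nat.
Qed.

(** A common multiple r of several denominators is split instead of each
    denominator, so that all the resulting fractions live over the same
    field. *)
Lemma split_quotient (F K : fieldType) (iota : {rmorphism F -> K})
    (p q r : {poly F}) (a : fps F) (rs : seq K) :
    map_poly iota r %= \prod_(x <- rs) ('X - x%:P) -> q %| r ->
    fps_eq_quotient a p q ->
  exists (t : seq K) (R : {poly K}), (size R <= size t)%N /\
    fps_eq_quotient (fps_map iota a) R (recip_prod t).
Proof.
move=> splits q_dv_r [q_neq0 /(fps_map_mul iota) eqp].
have /dvdp_prod_XsubC[m] : map_poly iota q %| \prod_(x <- rs) ('X - x%:P).
  by rewrite -(eqp_dvdr _ splits) dvdp_map.
set rs' := mask m rs => /eqpf_eq[c c_neq0 Dq].
rewrite Dq -mul_polyC in eqp; have [t [R eqR]] := recip_prod_of_roots eqp.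
have eqR' : fps_mul (fps_of_poly (recip_prod t)) (fps_map iota a)
            =1 fps_of_poly (c^-1 *: R).
  move=> n; rewrite /fps_of_poly coefZ -[R`_n]eqR mul_polyC fps_mulZl.
  by rewrite mulKf.
by have [t' szR quoR] := fps_eq_quotient_pad eqR'; exists t', (c^-1 *: R).
Qed.

Lemma recip_prod_ord (K : fieldType) m (alpha : 'I_m -> K) :
  recip_prod [seq alpha i | i <- enum 'I_m] =
  \prod_(i < m) (1 - alpha i *: 'X).
Proof. by rewrite /recip_prod big_map big_enum. Qed.

Lemma recip_prod_tnth (K : fieldType) (s : seq K) :
  recip_prod s = \prod_(i < size s) (1 - tnth (in_tuple s) i *: 'X).
Proof. exact: big_tnth. Qed.

(* [size p] is the degree of p plus one, and 0 for p = 0 (degree -oo): thus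
   [(size R <= m)%N] is deg R < m and [(size T <= m * n)%N] is
   deg T <= m n - 1, also when m n = 0. *)
Theorem theorem6 (F : fieldType) (charF0 : [pchar F] =i pred0)
    (A B : fps F) (ratA : rational_fps A) (ratB : rational_fps B) :
  (exists (K : fieldType) (iota : {rmorphism F -> K}) (m n : nat)
      (alpha : 'I_m -> K) (beta : 'I_n -> K) (R S : {poly K}),
    [/\ (size R <= m)%N,
        (size S <= n)%N,
        fps_eq_quotient (fps_map iota A) R
          (\prod_(i < m) (1 - alpha i *: 'X))
      & fps_eq_quotient (fps_map iota B) S
          (\prod_(j < n) (1 - beta j *: 'X))])
  /\
  (forall (K : fieldType) (iota : {rmorphism F -> K}) (m n : nat)
      (alpha : 'I_m -> K) (beta : 'I_n -> K) (R S : {poly K}),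
    (size R <= m)%N ->
    (size S <= n)%N ->
    fps_eq_quotient (fps_map iota A) R (\prod_(i < m) (1 - alpha i *: 'X)) ->
    fps_eq_quotient (fps_map iota B) S (\prod_(j < n) (1 - beta j *: 'X)) ->
    exists T : {poly K},
      (size T <= m * n)%N /\
      fps_eq_quotient (fps_map iota (binomial_product A B)) T
        (\prod_(i < m) \prod_(j < n) (1 - (alpha i + beta j) *: 'X))).
Proof.
split.
  have [[pA [qA quoA]] [pB [qB quoB]]] := (ratA, ratB).
  have qAB_neq0 : qA * qB != 0 by rewrite mulf_neq0 ?(proj1 quoA) ?(proj1 quoB).
  have [K [iota [rs splits]]] := exists_splitting_ext qAB_neq0.
  have [s [R [szR quoR]]] := split_quotient splits (dvdp_mulr _ (dvdpp _)) quoA.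
  have [t [S [szS quoS]]] := split_quotient splits (dvdp_mull _ (dvdpp _)) quoB.
  exists K, iota, (size s), (size t).
  exists (tnth (in_tuple s)), (tnth (in_tuple t)), R, S.
  by rewrite -!recip_prod_tnth.
move=> K iota m n alpha beta R S szR szS quoR quoS.
pose s := [seq alpha i | i <- enum 'I_m].
pose t := [seq beta j | j <- enum 'I_n].
have sz_s : size s = m by rewrite size_map size_enum_ord.
have sz_t : size t = n by rewrite size_map size_enum_ord.
rewrite -recip_prod_ord in quoR; rewrite -recip_prod_ord in quoS.
have s_A : kills (char_prod s) (fps_map iota A).
  by apply: kills_of_quotient quoR; rewrite sz_s.
have t_B : kills (char_prod t) (fps_map iota B).
  by apply: kills_of_quotient quoS; rewrite sz_t.
have st_AB := eq_kills (fsym (fps_map_binomial_product iota A B))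
  (kills_binomial_product s_A t_B).
have [T [szT quoT]] := quotient_of_kills st_AB.
exists T; split; first by rewrite size_allpairs sz_s sz_t in szT.
suff -> : \prod_(i < m) \prod_(j < n) (1 - (alpha i + beta j) *: 'X) =
          recip_prod (pair_sums s t) by [].
rewrite /recip_prod big_allpairs_dep big_map big_enum.
by apply: eq_bigr => i _; rewrite big_map big_enum.
Qed.
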